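(* $\mathsf{dL}_{\mathrm{CHP}}$ is a conservative extension of $\mathsf{dL}$: for every formula $\varphi$ belonging both to $\mathsf{dL}_{\mathrm{CHP}}$ and to $\mathsf{dL}$, in which every continuous evolution contains the equation $\mu'=1$ for the global time $\mu$, $\varphi$ is valid in $\mathsf{dL}_{\mathrm{CHP}}$ if and only if $\varphi$ is valid in $\mathsf{dL}$.
   Context: **Syntax.** $V=V_{\mathbb R}\cup V_{\mathbb N}\cup V_{\mathcal T}$ is a disjoint union of real, integer and trace variables; $\mu\in V_{\mathbb R}$ is the designated global time variable. Formulas common to $\mathsf{dL}$ and $\mathsf{dL}_{\mathrm{CHP}}$: $\varphi,\psi::=\theta_1=\theta_2\mid\theta_1\ge\theta_2\mid\neg\varphi\mid\varphi\wedge\psi\mid\varphi\vee\psi\mid\varphi\to\psi\mid\forall x\,\varphi\mid\exists x\,\varphi\mid[\alpha]\psi$ with $x\in V_{\mathbb R}$, $\theta_i\in\mathbb Q[V_{\mathbb R}]$, and $\alpha$ a hybrid program $\alpha,\beta::=x:=\theta\mid x:=*\mid?\chi\mid\{x'=\theta\,\&\,\chi\}\mid\alpha;\beta\mid\alpha\cup\beta\mid\alpha^*$, $\chi$ a formula of first-order real arithmetic over $V_{\mathbb R}$. In differential equations $x$ may be a list of distinct variables with a list $\theta$ of right-hand sides; if $\mu$ is in the list its right-hand side is $1$. $\alpha^0\equiv{?\mathrm{true}}$, $\alpha^{n+1}\equiv\alpha;\alpha^n$. **$\mathsf{dL}$ semantics.** A real state is a map $V_{\mathbb R}\to\mathbb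 R$; $\mathcal R$ is the set of real states. Programs denote relations on $\mathcal R$: $[\![x:=\theta]\!]_{dL}=\{(v,v[x\mapsto\theta(v)])\}$; $[\![x:=*]\!]_{dL}=\{(v,v[x\mapsto a])\mid a\in\mathbb R\}$; $[\![?\chi]\!]_{dL}=\{(v,v)\mid v\models_{dL}\chi\}$; $[\![\{x'=\theta\&\chi\}]\!]_{dL}$ is the set of $(\phi(0),\phi(s))$ for $s\ge0$ and $\phi:[0,s]\to\mathcal R$ solving $x'=\theta$ on $[0,s]$ (derivative condition vacuous if $s=0$), with $\phi(\zeta)\models_{dL}\chi$ and $\phi(\zeta)=\phi(0)$ off $\{x\}$ for all $\zeta$; $\cup$, $;$ and $*$ are union, relational composition, and $\bigcup_n[\![\alpha^n]\!]_{dL}$. Satisfaction $\models_{dL}$ is usual, with $v\models_{dL}[\alpha]\psi$ iff $w\models_{dL}\psi$ for all $(v,w)\in[\![\alpha]\!]_{dL}$. Valid in $\mathsf{dL}$: true in all real states. **$\mathsf{dL}_{\mathrm{CHP}}$ semantics.** A state maps each variable in $V$ to a value of its sort (real, natural number, communication trace, i.e. a finite sequence of events $\langle ch,a,s\rangle$ with channel $ch$ and $a,s\in\mathbb R$, chronological in $s$); $\mathcal S$ is the set of states, $\mathcal S_\bot=\mathcal S\cup\{\bot\}$. Programs denote subsets of $\mathcal S\times\mathcal T_{rec}\times\mathcal S_\bot$, where $\mathcal T_{rec}$ is the set of traces whose events additionally carry a recorder variable in $V_{\mathcal T}$. With $\bot_{\mathcal D}=\mathcal S\times\{\epsilon\}\times\{\bot\}$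 ($\epsilon$ the empty trace): $[\![x:=\theta]\!]=\bot_{\mathcal D}\cup\{(v,\epsilon,v[x\mapsto\theta(v)])\}$; $[\![x:=*]\!]=\bot_{\mathcal D}\cup\{(v,\epsilon,v[x\mapsto a])\mid a\in\mathbb R\}$; $[\![?\chi]\!]=\bot_{\mathcal D}\cup\{(v,\epsilon,v)\mid v\models\chi\}$; $[\![\{x'=\theta\&\chi\}]\!]=\bot_{\mathcal D}\cup\{(\phi(0),\epsilon,\phi(s))\}$ over $s\ge0$ and $\phi:[0,s]\to\mathcal S$ solving $\mu'=1,x'=\theta$ (derivative condition vacuous if $s=0$), with $\phi(\zeta)\models\chi$ and $\phi(\zeta)=\phi(0)$ off $\{x,\mu\}$ for all $\zeta$; $[\![\alpha\cup\beta]\!]=[\![\alpha]\!]\cup[\![\beta]\!]$; $[\![\alpha;\beta]\!]=\{(v,\tau,\bot)\mid(v,\tau,w)\in[\![\alpha]\!]\}\cup\{(v,\tau_1\cdot\tau_2,w)\mid(v,\tau_1,u)\in[\![\alpha]\!],u\neq\bot,(u,\tau_2,w)\in[\![\beta]\!]\}$; $[\![\alpha^*]\!]=\bigcup_n[\![\alpha^n]\!]$. Satisfaction $\models$ is usual, with $v\models[\alpha]\psi$ iff $w\cdot\tau\models\psi$ for all $(v,\tau,w)\in[\![\alpha]\!]$ with $w\ne\bot$, where $w\cdot\tau$ appends the events of $\tau$ to the trace variables recording them (so $w\cdot\epsilon=w$). Valid in $\mathsf{dL}_{\mathrm{CHP}}$: true in all states. *)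

(* Defs.v *)
From mathcomp Require Import all_boot all_order all_algebra.
From mathcomp Require finmap.
From mathcomp.multinomials Require monalg.
From mathcomp Require all_classical all_reals all_analysis.

Set Implicit Arguments.
Unset Strict Implicit.
Unset Printing Implicit Defensive.

(* The module confines the imports: the notations of monalg and those of
   mathcomp-analysis cannot be active together. *)
Module RatPoly.
Import finmap.finmap monalg.
Import GRing.Theory Num.Theory.
Local Open Scope ring_scope.

Definition ratpoly (V : choiceType) : comNzRingType := {malg rat[{cmonom V}]}.

Definition peval (V : choiceType) (K : numFieldType) (s : V -> K)
    (p : ratpoly V) : K :=
  mmap ratr (fun m : {cmonom V} => \prod_(x <- finsupp m) s x ^+ m x) p.

End RatPoly.

Import all_classical all_reals all_analysis.
Import Order.TTheory GRing.Theory Num.Theory.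
Import numFieldNormedType.Exports.
Local Open Scope classical_set_scope.
Local Open Scope ring_scope.

Notation ratpoly := RatPoly.ratpoly.
Notation peval := RatPoly.peval.

(* The variables V are the disjoint union of VR (real), VN (integer) and
   VT (trace), see [var] below; [gtime] is the global time variable mu. *)
Record signature := Signature {
  VR : choiceType;
  VN : choiceType;
  VT : choiceType;
  chan : Type;
  gtime : VR }.

Inductive fol (S : signature) : Type :=
| FEq of ratpoly (VR S) & ratpoly (VR S)
| FGe of ratpoly (VR S) & ratpoly (VR S)
| FNot of fol S
| FAnd of fol S & fol S
| FOr of fol S & fol S
| FImp of fol S & fol S
| FAll of VR S & fol S
| FEx of VR S & fol S.

Definition FTrue (S : signature) : fol S := FEq 0 0.

(* The list of equations may be empty (this is excluded by [prog_timed]). *)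
Record odesys (S : signature) := OdeSys {
  ode_eqs : seq (VR S * ratpoly (VR S));
  ode_distinct : uniq (unzip1 ode_eqs);
  ode_gtime : all (fun e => (e.1 == gtime S) ==> (e.2 == 1)) ode_eqs }.

Definition ode_vars (S : signature) (o : odesys S) : seq (VR S) :=
  unzip1 (ode_eqs o).

Inductive prog (S : signature) : Type :=
| PAssign of VR S & ratpoly (VR S)
| PRandom of VR S
| PTest of fol S
| POde of odesys S & fol S
| PSeq of prog S & prog S
| PChoice of prog S & prog S
| PStar of prog S.

Fixpoint prog_iter (S : signature) (a : prog S) (n : nat) : prog S :=
  if n is n'.+1 then PSeq a (prog_iter a n') else PTest (FTrue S).

(* The formulas common to dL and dL_CHP; programs communicate only outside of
   this fragment, so that the dL_CHP syntax is not needed in full. *)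
Inductive formula (S : signature) : Type :=
| Eq of ratpoly (VR S) & ratpoly (VR S)
| Ge of ratpoly (VR S) & ratpoly (VR S)
| Not of formula S
| And of formula S & formula S
| Or of formula S & formula S
| Imp of formula S & formula S
| All of VR S & formula S
| Ex of VR S & formula S
| Box of prog S & formula S.

Fixpoint prog_timed (S : signature) (a : prog S) : bool :=
  match a with
  | PAssign _ _ | PRandom _ | PTest _ => true
  | POde o _ => (gtime S, 1) \in ode_eqs o
  | PSeq a b | PChoice a b => prog_timed a && prog_timed b
  | PStar a => prog_timed a
  end.

Fixpoint timed (S : signature) (f : formula S) : bool :=
  match f with
  | Eq _ _ | Ge _ _ => true
  | Not f | All _ f | Ex _ f => timed f
  | And f g | Or f g | Imp f g => timed f && timed g
  | Box a f => prog_timed a && timed f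
  end.

(* The derivative at [z] relative to [[0, s]], hence one-sided at the end
   points; [z^'] excludes the point [z] itself. *)
Definition derivative_on (R : realType) (s : R) (f : R -> R) (z l : R) : Prop :=
  (f t - f z) / (t - z) @[t --> within `[0, s] z^'] --> l.

(* A function on [[0, s]] is encoded as a total one: its values outside of
   [[0, s]] are irrelevant here and in [dl_ode] and [chp_ode]. *)
Definition solves (R : realType) (V : choiceType) (s : R) (phi : R -> V -> R)
    (eqs : seq (V * ratpoly V)) : Prop :=
  0 < s -> forall z, z \in `[0, s] -> forall e, e \in eqs ->
    derivative_on s (fun t => phi t e.1) z (peval (phi z) e.2).

Definition rstate (R : realType) (S : signature) := VR S -> R.

Definition rupd (R : realType) (S : signature) (v : rstate R S) (x : VR S)
    (a : R) : rstate R S :=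
  fun y => if y == x then a else v y.

Fixpoint dl_fol (R : realType) (S : signature) (c : fol S)
    (v : rstate R S) : Prop :=
  match c with
  | FEq p q => peval v p = peval v q
  | FGe p q => peval v p >= peval v q
  | FNot c => ~ dl_fol c v
  | FAnd c d => dl_fol c v /\ dl_fol d v
  | FOr c d => dl_fol c v \/ dl_fol d v
  | FImp c d => dl_fol c v -> dl_fol d v
  | FAll x c => forall a, dl_fol c (rupd v x a)
  | FEx x c => exists a, dl_fol c (rupd v x a)
  end.

Definition dl_den (R : realType) (S : signature) := set (rstate R S * rstate R S).

Definition dl_test (R : realType) (S : signature) (c : fol S) : dl_den R S :=
  [set p | p.2 = p.1 /\ dl_fol c p.1].

Definition dl_ode (R : realType) (S : signature) (o : odesys S) (c : fol S) :
    dl_den R S :=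
  [set p | exists (s : R) (phi : R -> rstate R S),
    [/\ 0 <= s, p = (phi 0, phi s), solves s phi (ode_eqs o) &
        forall z, z \in `[0, s] ->
          dl_fol c (phi z) /\
          forall x, x \notin ode_vars o -> phi z x = phi 0 x]].

Definition dl_comp (R : realType) (S : signature) (A B : dl_den R S) :
    dl_den R S :=
  [set p | exists u, A (p.1, u) /\ B (u, p.2)].

(* The iterates are taken on denotations because the recursion on programs
   has to be structural; [dl_prog_star] gives the reading on programs. *)
Fixpoint dl_iter (R : realType) (S : signature) (A : dl_den R S) (n : nat) :
    dl_den R S :=
  if n is n'.+1 then dl_comp A (dl_iter A n') else dl_test (FTrue S).

Fixpoint dl_prog (R : realType) (S : signature) (a : prog S) : dl_den R S :=
  match a with
  | PAssign x p => [set w | w.2 = rupd w.1 x (peval w.1 p)]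
  | PRandom x => [set w | exists r, w.2 = rupd w.1 x r]
  | PTest c => dl_test c
  | POde o c => dl_ode o c
  | PSeq a b => dl_comp (dl_prog a) (dl_prog b)
  | PChoice a b => dl_prog a `|` dl_prog b
  | PStar a => \bigcup_n dl_iter (dl_prog a) n
  end.

Lemma dl_prog_star (R : realType) (S : signature) (a : prog S) :
  dl_prog (PStar a) = \bigcup_n dl_prog (prog_iter a n) :> dl_den R S.
Proof. by apply: eq_bigcupr => n _; elim: n => //= n ->. Qed.

Fixpoint dl_sat (R : realType) (S : signature) (f : formula S)
    (v : rstate R S) : Prop :=
  match f with
  | Eq p q => peval v p = peval v q
  | Ge p q => peval v p >= peval v q
  | Not f => ~ dl_sat f v
  | And f g => dl_sat f v /\ dl_sat g v
  | Or f g => dl_sat f v \/ dl_sat g v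
  | Imp f g => dl_sat f v -> dl_sat g v
  | All x f => forall a, dl_sat f (rupd v x a)
  | Ex x f => exists a, dl_sat f (rupd v x a)
  | Box a f => forall w, dl_prog a (v, w) -> dl_sat f w
  end.

Definition dl_valid (R : realType) (S : signature) (f : formula S) : Prop :=
  forall v : rstate R S, dl_sat f v.

Record event (R : realType) (S : signature) := Event {
  ev_chan : chan S;
  ev_val : R;
  ev_time : R }.

Definition trace (R : realType) (S : signature) :=
  {t : seq (event R S) | sorted (relpre (@ev_time R S) <=%R) t}.

(* The first component of an event is its recorder variable. *)
Definition rtrace (R : realType) (S : signature) :=
  {t : seq (VT S * event R S) |
    sorted (relpre (fun e => ev_time e.2) <=%R) t}.

Definition rtrace0 (R : realType) (S : signature) : rtrace R S :=
  exist _ [::] isT.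

Inductive var (S : signature) : Type :=
| RVar of VR S
| NVar of VN S
| TVar of VT S.

Definition value (R : realType) (S : signature) (x : var S) : Type :=
  match x with
  | RVar _ => R
  | NVar _ => nat
  | TVar _ => trace R S
  end.

Definition state (R : realType) (S : signature) := forall x : var S, value R x.

Definition real_part (R : realType) (S : signature) (v : state R S) :
    rstate R S :=
  fun x => v (RVar x).

Definition upd (R : realType) (S : signature) (v : state R S) (x : VR S)
    (a : R) : state R S :=
  fun y => match y return value R y with
           | RVar y => if y == x then a else v (RVar y)
           | NVar n => v (NVar n)
           | TVar h => v (TVar h)
           end.

(* [cat_state w t u] says that [w . t] is the state [u]. The operation is
   partial, since the extended traces have to be chronological. *)
Definition cat_state (R : realType) (S : signature) (w : state R S)
    (t : rtrace R S) (u : state R S) : Prop :=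
  [/\ forall x, u (RVar x) = w (RVar x),
      forall n, u (NVar n) = w (NVar n) &
      forall h, sval (u (TVar h)) =
                sval (w (TVar h)) ++ [seq e.2 | e <- sval t & e.1 == h]].

Fixpoint chp_fol (R : realType) (S : signature) (c : fol S)
    (v : state R S) : Prop :=
  match c with
  | FEq p q => peval (real_part v) p = peval (real_part v) q
  | FGe p q => peval (real_part v) p >= peval (real_part v) q
  | FNot c => ~ chp_fol c v
  | FAnd c d => chp_fol c v /\ chp_fol d v
  | FOr c d => chp_fol c v \/ chp_fol d v
  | FImp c d => chp_fol c v -> chp_fol d v
  | FAll x c => forall a, chp_fol c (upd v x a)
  | FEx x c => exists a, chp_fol c (upd v x a)
  end.

(* The final state [None] is the bottom element, i.e. an unfinished run. *)
Definition chp_den (R : realType) (S : signature) :=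
  set (state R S * rtrace R S * option (state R S)).

Definition chp_bot (R : realType) (S : signature) : chp_den R S :=
  [set d | d.1.2 = rtrace0 R S /\ d.2 = None].

(* The runs without communication along a relation on states, and all the
   unfinished runs with the empty trace. *)
Definition chp_silent (R : realType) (S : signature)
    (A : set (state R S * state R S)) : chp_den R S :=
  @chp_bot R S `|` [set (p.1, rtrace0 R S, Some p.2) | p in A].

Definition chp_test (R : realType) (S : signature) (c : fol S) : chp_den R S :=
  chp_silent [set p | p.2 = p.1 /\ chp_fol c p.1].

(* The global time always evolves, whether or not it is among [ode_vars o]. *)
Definition chp_ode (R : realType) (S : signature) (o : odesys S) (c : fol S) :
    chp_den R S :=
  chp_silent [set p | exists (s : R) (phi : R -> state R S),
    [/\ 0 <= s, p = (phi 0, phi s),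
        solves s (fun t => real_part (phi t)) ((gtime S, 1) :: ode_eqs o) &
        forall z, z \in `[0, s] ->
          chp_fol c (phi z) /\
          forall y : var S,
            (forall x, x \in gtime S :: ode_vars o -> y <> RVar x) ->
            phi z y = phi 0 y]].

Definition chp_comp (R : realType) (S : signature) (A B : chp_den R S) :
    chp_den R S :=
  [set d | d.2 = None /\ exists w, A (d.1, w)] `|`
  [set d | exists (t1 t2 : rtrace R S) (u : state R S),
    [/\ sval d.1.2 = sval t1 ++ sval t2,
        A (d.1.1, t1, Some u) & B (u, t2, d.2)]].

Fixpoint chp_iter (R : realType) (S : signature) (A : chp_den R S) (n : nat) :
    chp_den R S :=
  if n is n'.+1 then chp_comp A (chp_iter A n') else chp_test (FTrue S).

Fixpoint chp_prog (R : realType) (S : signature) (a : prog S) : chp_den R S :=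
  match a with
  | PAssign x p =>
      chp_silent [set w | w.2 = upd w.1 x (peval (real_part w.1) p)]
  | PRandom x => chp_silent [set w | exists r, w.2 = upd w.1 x r]
  | PTest c => chp_test c
  | POde o c => chp_ode o c
  | PSeq a b => chp_comp (chp_prog a) (chp_prog b)
  | PChoice a b => chp_prog a `|` chp_prog b
  | PStar a => \bigcup_n chp_iter (chp_prog a) n
  end.

Lemma chp_prog_star (R : realType) (S : signature) (a : prog S) :
  chp_prog (PStar a) = \bigcup_n chp_prog (prog_iter a n) :> chp_den R S.
Proof. by apply: eq_bigcupr => n _; elim: n => //= n ->. Qed.

Fixpoint chp_sat (R : realType) (S : signature) (f : formula S)
    (v : state R S) : Prop :=
  match f with
  | Eq p q => peval (real_part v) p = peval (real_part v) q
  | Ge p q => peval (real_part v) p >= peval (real_part v) q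
  | Not f => ~ chp_sat f v
  | And f g => chp_sat f v /\ chp_sat g v
  | Or f g => chp_sat f v \/ chp_sat g v
  | Imp f g => chp_sat f v -> chp_sat g v
  | All x f => forall a, chp_sat f (upd v x a)
  | Ex x f => exists a, chp_sat f (upd v x a)
  | Box a f => forall (t : rtrace R S) (w u : state R S),
      chp_prog a (v, t, Some w) -> cat_state w t u -> chp_sat f u
  end.

Definition chp_valid (R : realType) (S : signature) (f : formula S) : Prop :=
  forall v : state R S, chp_sat f v.

Arguments dl_valid R {S} f.
Arguments chp_valid R {S} f.

(* Main.v *)
Require Import Defs.
From mathcomp Require Import all_boot all_order all_algebra.
From mathcomp Require Import all_classical all_reals all_analysis.

(** A program of the common fragment neither communicates nor writes a variable
    that is not real, so its finished runs are exactly its [dL] runs on the real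
    part of the state; [timed] makes this true of continuous evolutions, where
    [dL_CHP] moves the global time in any case. Hence satisfaction depends only
    on the real part of the state, and every real state is one. *)

Import Order.TTheory GRing.Theory.
Local Open Scope classical_set_scope.
Local Open Scope ring_scope.

(** Lifts a real state to a full one; the integer and trace variables are borrowed from [v], since
    the fragment never changes them. *)
Definition with_real {R : realType} {S : signature} (v : state R S)
    (r : rstate R S) : state R S :=
  fun y => match y return value R y with
           | RVar x => r x
           | NVar n => v (NVar n)
           | TVar h => v (TVar h)
           end.

(** Any full state would do: it only supplies integer and trace values when a real state has to be
    lifted. *)
Definition default_state (R : realType) (S : signature) : state R S :=
  fun y => match y return value R y with
           | RVar _ => 0
           | NVar _ => 0%N
           | TVar _ => exist _ [::] isT
           end.

Lemma state_ext {R : realType} {S : signature} (v w : state R S) :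
  (forall y, v y = w y) -> v = w.
Proof. exact: functional_extensionality_dep. Qed.

Lemma with_real_real_part {R : realType} {S : signature} (v : state R S) :
  with_real v (real_part v) = v.
Proof. by apply: state_ext; case. Qed.

Lemma with_realK {R : realType} {S : signature} (v : state R S)
    (r r' : rstate R S) :
  with_real (with_real v r) r' = with_real v r'.
Proof. by apply: state_ext; case. Qed.

Lemma updE {R : realType} {S : signature} (v : state R S) (x : VR S) (a : R) :
  upd v x a = with_real v (rupd (real_part v) x a).
Proof. by apply: state_ext; case. Qed.

Lemma sval_bool_inj {T : Type} {P : pred T} (s t : {x | P x}) :
  sval s = sval t -> s = t.
Proof.
case: s t => [x px] [y py] /= exy; case: y / exy py => py.
by congr exist; apply: bool_irrelevance.
Qed.

Lemma cat_state0 {R : realType} {S : signature} (w u : state R S) :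
  cat_state w (rtrace0 R S) u <-> u = w.
Proof.
split=> [[uR uN uT]|->]; last by split=> // h /=; rewrite cats0.
apply: state_ext; case=> [x|n|h]; [exact: uR | exact: uN |].
by apply: sval_bool_inj; rewrite uT cats0.
Qed.

Lemma chp_folE {R : realType} {S : signature} (c : fol S) (v : state R S) :
  chp_fol c v <-> dl_fol c (real_part v).
Proof.
elim: c v => [p q|p q|c IH|c IHc d IHd|c IHc d IHd|c IHc d IHd|x c IH|x c IH] v //=.
- by rewrite IH.
- by rewrite IHc IHd.
- by rewrite IHc IHd.
- by rewrite IHc IHd.
(* Up to conversion, [real_part (upd v x a)] is [rupd (real_part v) x a]. *)
- by split=> H a; apply/(IH (upd v x a)); exact: H.
- by split=> -[a H]; exists a; apply/(IH (upd v x a)).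
Qed.

(** Only finished runs are constrained, as a box ignores the others. The equation on [w] keeps the
    integer and trace variables of [v], so a [dL] run determines the run lifting it; this lets the
    relation pass through composition. *)
Definition real_runs {R : realType} {S : signature} (C : chp_den R S)
    (A : dl_den R S) : Prop :=
  forall v t w, C (v, t, Some w) <->
    [/\ t = rtrace0 R S, w = with_real v (real_part w) &
        A (real_part v, real_part w)].

Lemma chp_silentE {R : realType} {S : signature}
    (A : set (state R S * state R S)) (v w : state R S) (t : rtrace R S) :
  chp_silent A (v, t, Some w) <-> t = rtrace0 R S /\ A (v, w).
Proof.
split=> [[[_]//|[[v' w'] Avw [<- <- <-]]//]|[-> Avw]].
by right; exists (v, w).
Qed.

Lemma real_runs_silent {R : realType} {S : signature}
    (C : set (state R S * state R S)) (A : dl_den R S) :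
  (forall v w, C (v, w) <->
     w = with_real v (real_part w) /\ A (real_part v, real_part w)) ->
  real_runs (chp_silent C) A.
Proof. by move=> CA v t w; rewrite chp_silentE CA; split=> [[? []]|[]]. Qed.

Lemma real_runs_assign {R : realType} {S : signature} (x : VR S)
    (p : ratpoly (VR S)) :
  real_runs (chp_prog (R := R) (PAssign x p)) (dl_prog (PAssign x p)).
Proof.
apply: real_runs_silent => v w /=; rewrite updE.
by split=> [->|[ew /= aw]] //; rewrite ew aw.
Qed.

Lemma real_runs_random {R : realType} {S : signature} (x : VR S) :
  real_runs (chp_prog (R := R) (PRandom x)) (dl_prog (PRandom x)).
Proof.
apply: real_runs_silent => v w /=; split=> [[r ->]|[ew [r /= aw]]].
  by rewrite updE; split=> //; exists r.
by exists r; rewrite updE ew aw.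
Qed.

Lemma real_runs_test {R : realType} {S : signature} (c : fol S) :
  real_runs (chp_test (R := R) c) (dl_test c).
Proof.
apply: real_runs_silent => v w /=; rewrite chp_folE.
split=> [[-> cv]|[ew [/= aw cv]]]; first by rewrite with_real_real_part.
by rewrite ew aw with_real_real_part.
Qed.

(** The hypothesis makes [gtime S] an evolving variable of [o] with slope 1, so the equation and the
    freedom that [chp_ode] adds are already present in [dl_ode]. *)
Lemma real_runs_ode {R : realType} {S : signature} (o : odesys S) (c : fol S) :
  (gtime S, 1) \in ode_eqs o -> real_runs (chp_ode (R := R) o c) (dl_ode o c).
Proof.
move=> mu_o; have mu_vars : gtime S \in ode_vars o.
  exact: (map_f fst mu_o).
apply: real_runs_silent => v w /=.
split=> [[s [phi [s0 [-> ->] sol ev]]]|[ew [s [phi [s0 [ev0 ews] sol ev]]]]].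
- have s_in : s \in `[0, s] by rewrite in_itv /= s0 lexx.
  split.
    (* The frame condition at the end time [s] covers every variable that is not real. *)
    have [_ fixs] := ev s s_in; apply: state_ext; case=> [x|n|h] //.
      by apply: (fixs (NVar n)).
    by apply: (fixs (TVar h)).
  exists s, (fun t => real_part (phi t)); split=> //.
    by move=> lt0s z zs e eo; apply: sol => //; rewrite inE eo orbT.
  move=> z zs; have [cz fixz] := ev z zs; split; first exact/chp_folE.
  move=> x xo; apply: (fixz (RVar x)) => y; rewrite inE => yo [exy].
  by move: xo; rewrite exy; case/predU1P: yo => [->|->] //; rewrite mu_vars.
(* The [dL] flow is lifted by freezing the integer and trace variables at their values in [v]. *)
- exists s, (fun t => with_real v (phi t)); split=> //.
  + by rewrite -ev0 -ews -ew with_real_real_part.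
  + move=> lt0s z zs e; rewrite inE => /predU1P[->|eo]; last exact: sol.
    (* The added equation for the global time is one of the equations of [o]. *)
    exact: (sol lt0s z zs _ mu_o).
  + move=> z zs; have [cz fixz] := ev z zs; split; first exact/chp_folE.
    case=> //= x xo; apply: fixz; apply/negP => xin.
    by apply: (xo x) => //; rewrite inE xin orbT.
Qed.

Lemma real_runs_comp {R : realType} {S : signature} (C D : chp_den R S)
    (A B : dl_den R S) :
  real_runs C A -> real_runs D B -> real_runs (chp_comp C D) (dl_comp A B).
Proof.
move=> CA DB v t w; split.
(* The first part of [chp_comp] ends in [None], so a finished run comes from the second. *)
- case=> [[]//|[t1 [t2 [u [/= et /CA[e1 eu Au] /DB[e2 ew Bw]]]]]].
  split.
  + by apply: sval_bool_inj; rewrite et e1 e2.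
  + by rewrite {1}ew eu with_realK.
  + by exists (real_part u).
- move=> [-> ew [r [/= Ar Br]]]; right.
  (* The intermediate real state [r] is lifted along [v], which both halves of the run preserve. *)
  exists (rtrace0 R S), (rtrace0 R S), (with_real v r); split=> //=.
    exact/CA.
  by apply/DB; split=> //; rewrite with_realK.
Qed.

Lemma real_runs_iter {R : realType} {S : signature} (C : chp_den R S)
    (A : dl_den R S) (n : nat) :
  real_runs C A -> real_runs (chp_iter C n) (dl_iter A n).
Proof.
by move=> CA; elim: n => [|n IH] /=; [exact: real_runs_test | exact: real_runs_comp].
Qed.

Lemma real_runs_prog {R : realType} {S : signature} (a : prog S) :
  prog_timed a -> real_runs (chp_prog (R := R) a) (dl_prog a).
Proof.
elim: a => [x p|x|c|o c|a IHa b IHb|a IHa b IHb|a IHa].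
- by move=> _; exact: real_runs_assign.
- by move=> _; exact: real_runs_random.
- by move=> _; exact: real_runs_test.
- exact: real_runs_ode.
- by move=> /= /andP[/IHa ? /IHb ?]; exact: real_runs_comp.
- move=> /= /andP[/IHa CA /IHb CB] v t w.
  split=> [[/CA[]|/CB[]] ? ? ?|[? ? [?|?]]].
  + by split=> //; left.
  + by split=> //; right.
  + by left; apply/CA.
  + by right; apply/CB.
- move=> /= /IHa CA v t w; split=> [[n _ /(real_runs_iter _ _ n CA)[? ? ?]]|].
    by split=> //; exists n.
  by move=> [? ? [n _ ?]]; exists n => //; apply/(real_runs_iter _ _ n CA).
Qed.

Lemma chp_satE {R : realType} {S : signature} (f : formula S) (v : state R S) :
  timed f -> chp_sat f v <-> dl_sat f (real_part v).
Proof.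
elim: f v => [p q|p q|f IH|f IHf g IHg|f IHf g IHg|f IHf g IHg|x f IH|x f IH|a f IH] v //=.
- by move=> /IH ->.
- by move=> /andP[/IHf -> /IHg ->].
- by move=> /andP[/IHf -> /IHg ->].
- by move=> /andP[/IHf -> /IHg ->].
- by move=> tf; split=> H r; apply/(IH (upd v x r) tf); exact: H.
- by move=> tf; split=> -[r H]; exists r; apply/(IH (upd v x r) tf).
- move=> /andP[/real_runs_prog runs tf]; split=> [H r ar|H t w u].
    (* A [dL] run to [r] lifts to a silent run to [with_real v r], whose real part is [r] by
       conversion. *)
    apply/(IH (with_real v r) tf); apply: (H (rtrace0 R S) (with_real v r)).
      exact/runs.
    exact/cat_state0.
  (* The trace is empty, so appending it leaves the final state [w] unchanged. *)
  by move=> /runs[-> _ aw] /cat_state0 ->; apply/IH => //; exact: H.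
Qed.

Theorem proposition1 (R : realType) (S : signature) (phi : formula S)
    (hphi : timed phi) :
  chp_valid R phi <-> dl_valid R phi.
Proof.
split=> H v; last exact/chp_satE.
exact/(chp_satE _ (with_real (default_state R S) v) hphi).
Qed.
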